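(* Let $X$ be an infinite set of cardinality $\kappa$. Let $\mathfrak{P}$ be any partial order with a smallest element and with $|\mathfrak{P}|\leq 2^\kappa$, and let $\mathfrak{L}$ be the lattice of order ideals of $\mathfrak{P}$. Then there exists a monoidal interval in the clone lattice over $X$ which is isomorphic (as a lattice) to $\mathfrak{L}$.
   Context: For $n\ge 1$, $\mathcal{O}^{(n)}$ is the set of all $n$-ary operations $X^n\to X$, and $\mathcal{O}=\bigcup_{n\geq 1}\mathcal{O}^{(n)}$. A clone on $X$ is a set $\mathcal{C}\subseteq\mathcal{O}$ closed under composition and containing all projections $\pi^n_k(x_1,\ldots,x_n)=x_k$ ($1\le k\le n$). The clone lattice $Cl(X)$ is the set of all clones on $X$ ordered by inclusion. For a submonoid $\mathcal{G}$ of $\mathcal{O}^{(1)}$ (under composition, containing the identity), the monoidal interval $\mathcal{I}_{\mathcal{G}}$ is the set of all clones $\mathcal{C}$ on $X$ with $\mathcal{C}\cap\mathcal{O}^{(1)}=\mathcal{G}$, ordered by inclusion; it is an interval of $Cl(X)$. A monoidal interval is an interval of the form $\mathcal{I}_{\mathcal{G}}$. An order ideal of a partial order is a lower (downward closed) subset, the empty set included; the lattice of order ideals consists of all order ideals with intersection and union as operations. *)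

(* Defs.v *)
From HB Require Import structures.
From mathcomp Require Import all_boot all_order.
From mathcomp Require Import boolp classical_sets functions cardinality.

Set Implicit Arguments.
Unset Strict Implicit.
Unset Printing Implicit Defensive.

Local Open Scope classical_set_scope.

(* Nullary operations are excluded: [Op f] packs an operation [f] of arity
   [n.+1], so that [operation X] is the union over all arities [>= 1]. *)
Inductive operation (X : Type) : Type :=
  Op (n : nat) of (('I_n.+1 -> X) -> X).

Definition proj (X : Type) (n : nat) (k : 'I_n.+1) : ('I_n.+1 -> X) -> X :=
  fun x => x k.

Definition compose (X : Type) (n m : nat) (f : ('I_n.+1 -> X) -> X)
    (g : 'I_n.+1 -> ('I_m.+1 -> X) -> X) : ('I_m.+1 -> X) -> X :=
  fun x => f (fun i => g i x).

Definition unary (X : Type) : set (operation X) := range (@Op X 0).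

Arguments unary X : clear implicits.

Definition is_clone (X : Type) (C : set (operation X)) : Prop :=
  (forall (n : nat) (k : 'I_n.+1), C (Op (@proj X n k))) /\
  (forall (n m : nat) (f : ('I_n.+1 -> X) -> X)
      (g : 'I_n.+1 -> ('I_m.+1 -> X) -> X),
    C (Op f) -> (forall i, C (Op (g i))) -> C (Op (compose f g))).

Definition is_submonoid (X : Type) (G : set (operation X)) : Prop :=
  [/\ G `<=` unary X,
      G (Op (@proj X 0 ord0)) &
      forall f g : ('I_1 -> X) -> X,
        G (Op f) -> G (Op g) -> G (Op (compose f (fun=> g)))].

Definition monoidal_interval (X : Type) (G : set (operation X)) :
    set (set (operation X)) :=
  [set C | is_clone C /\ C `&` unary X = G].

(* The join in the clone lattice, i.e. the clone generated by the union; the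
   meet is the intersection. A monoidal interval, being an interval of the
   clone lattice, has the same meets and joins. *)
Definition clone_join (X : Type) (C D : set (operation X)) :
    set (operation X) :=
  smallest (@is_clone X) (C `|` D).

Definition order_ideals (d : Order.disp_t) (P : porderType d) : set (set P) :=
  [set I | forall x y : P, (x <= y)%O -> I y -> I x].

(* [A] and [B] are the carriers of the two lattices; the operations are only
   relevant on them. *)
Definition lattice_isomorphic (T U : Type)
    (A : set T) (meetA joinA : T -> T -> T)
    (B : set U) (meetB joinB : U -> U -> U) : Prop :=
  exists phi : T -> U,
    [/\ set_bij A B phi,
        (forall x y, A x -> A y -> phi (meetA x y) = meetB (phi x) (phi y)) &
        (forall x y, A x -> A y -> phi (joinA x y) = joinB (phi x) (phi y))].

(* Main.v *)
Require Import Defs.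
From mathcomp Require Import all_boot all_order.
From mathcomp Require Import boolp classical_sets functions cardinality.

Set Implicit Arguments.
Unset Strict Implicit.
Unset Printing Implicit Defensive.

Import Order.TTheory.

Local Open Scope classical_set_scope.
Local Open Scope card_scope.

(** The set X is identified with a set of points of four sorts: an origin Zero,
    three keys, an index Idx i for each i in X, and over each i a fibre of cells
    Cell i None (the base cell), Cell i (Some t) for t in a set T of values.
    Cantor-Bernstein and |X x nat| = |X| make this identification possible.

    A map s : X -> T is read as a section, sending Idx i to Cell i (Some (s i)).
    There are at least 2^|X| sections, so a map rank from the sections onto the
    partial order P exists.  The monoid G consists of the constants, all
    sections (that of base cells included), some small spikes supported on two of
    the three keys, and the maps act rho r, where rho permutes the keys
    and r acts on the cells fibre by fibre and never increases the rank of a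
    section.  The only essentially binary operations that turn out
    to preserve G are the gates: gate a s x y applies the section s to x when
    the key y differs from a, and the section of base cells otherwise.  Composing
    a gate of s with the monoid produces exactly the gates of the sections of
    rank at most rank s, and a gate never composes with another gate in a new
    way, because its values are cells or Zero, which a gate treats like Zero.
    Hence each order ideal J of P yields a clone, the operations depending on one
    variable through G together with the gates of rank in J (gates_clone), and
    joins of such clones are unions.

    The substance is the converse, compat_classification: an operation all of
    whose substitution instances by members of G are in G depends on one variable
    or is a gate.  The constants put every one-variable slice of it into G, and
    the analysis starts from the slices through the origin.  The keys are
    responsible for rigidity.  Spikes are supported on exactly two keys out of
    three, so neither the conjunction nor the disjunction of two spikes is
    compatible with permuting the keys in one of the variables; this is a parity
    argument on 3 x 3 matrices (even_lines).  The fibres do the same for the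
    indices: a value over i reached by changing either of two variables would
    force the other variable to lie over i, for every i at once.  A clone with
    unary part G is then determined by the ranks of its gates
    (interval_gates), and every order ideal occurs.

    The least element of P is the rank of all sections that take a certain
    value star: the maps r needed to lower the rank of a given section s send
    every section other than s to one taking that value (exists_lowering). *)

(** * The ground set and the monoid *)

Notation key := (option bool).

Section Points.
Context (I : Type) (T : eqType) (d : Order.disp_t) (P : bPOrderType d).
Context (rank : (I -> T) -> P) (star : T).
Context (i0 i1 : I) (i01 : i0 <> i1).

Inductive point := Zero | Key of key | Idx of I | Cell of I & option T.

Definition act (rho : key -> key) (r : I -> T -> T) (x : point) : point :=
  match x with
  | Zero => Zero
  | Key a => Key (rho a)
  | Idx i => Idx i
  | Cell i t => Cell i (omap (r i) t)
  end.

(** The argument [None] stands for the section of base cells. *)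
Definition section (s : option (I -> T)) (x : point) : point :=
  if x is Idx i then Cell i (omap (@^~ i) s) else Zero.

(** The support of a spike is a two-element set of keys, coded by its
    complement. *)
Definition opens (a : key) (x : point) : bool :=
  if x is Key b then b != a else false.

Definition spike (a : key) (i : I) (t : T) (x : point) : point :=
  Cell i (if opens a x then Some t else None).

Definition gate (a : key) (s : I -> T) (x y : point) : point :=
  section (if opens a y then Some s else None) x.

(** This invariance is what encodes the order of [P] into the monoid. *)
Definition lowering (r : I -> T -> T) : Prop :=
  forall s, (rank (fun i => r i (s i)) <= rank s)%O.

(** An [act] fixes every index, and indices occur in no value of a section or of
    a spike; that is why the maps [act rho r] cannot be gated. *)
Inductive monoid_fun : (point -> point) -> Prop :=
| mon_act rho r : injective rho -> lowering r -> monoid_fun (act rho r)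
| mon_cst x : monoid_fun (fun=> x)
| mon_section s : monoid_fun (section s)
| mon_spike a i t : monoid_fun (spike a i t).

Lemma act_id x : act id (fun=> id) x = x.
Proof. by case: x => //= i [t|]. Qed.

Lemma lowering_id : lowering (fun=> id).
Proof. by move=> s. Qed.

Lemma mon_id : monoid_fun id.
Proof.
rewrite (_ : id = act id (fun=> id)); first by constructor.
by apply/funext=> x; rewrite act_id.
Qed.

Lemma opens_act a rho r x (rhoI : injective rho) :
  opens a (act rho r x) = opens (invF rhoI a) x.
Proof. by case: x => //= b; rewrite -(inj_eq rhoI b) f_invF. Qed.

Lemma section_act s rho r x : section s (act rho r x) = section s x.
Proof. by case: x. Qed.

Lemma act_section s rho r x :
  act rho r (section s x) = section (omap (fun s i => r i (s i)) s) x.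
Proof. by case: x => //= i; case: s. Qed.

Lemma lowering_comp r r' :
  lowering r -> lowering r' -> lowering (fun i => r i \o r' i).
Proof.
by move=> rl rl' s; apply: le_trans (rl' s); exact: (rl (fun i => r' i (s i))).
Qed.

Lemma mon_comp u v : monoid_fun u -> monoid_fun v -> monoid_fun (u \o v).
Proof.
move=> mu mv; case: mu => [rho r rhoI rl|x|s|a i t].
- case: mv => [rho' r' rhoI' rl'|x|s|a i t].
  + rewrite (_ : _ \o _ = act (rho \o rho') (fun i => r i \o r' i)).
      by constructor; [exact: inj_comp|exact: lowering_comp].
    by apply/funext=> -[|b|j|j [t|]].
  + exact: (mon_cst (act rho r x)).
  + rewrite (_ : _ \o _ = section (omap (fun s i => r i (s i)) s)).
      by constructor.
    by apply/funext=> x; rewrite /= act_section.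
  + rewrite (_ : _ \o _ = spike a i (r i t)); first by constructor.
    by apply/funext=> x; rewrite /= /spike; case: (opens a x).
- exact: mon_cst.
- case: mv => [rho' r' rhoI' rl'|x|s'|a i t].
  + rewrite (_ : _ \o _ = section s); first by constructor.
    by apply/funext=> x /=; rewrite section_act.
  + exact: (mon_cst (section s x)).
  + by rewrite (_ : _ \o _ = fun=> Zero); [constructor|apply/funext=> -[]].
  + exact: (mon_cst Zero).
- case: mv => [rho' r' rhoI' rl'|x|s'|a' i' t'].
  + rewrite (_ : _ \o _ = spike (invF rhoI' a) i t); first by constructor.
    by apply/funext=> x; rewrite /= /spike opens_act.
  + exact: (mon_cst (spike a i t x)).
  + by rewrite (_ : _ \o _ = fun=> Cell i None); [constructor|apply/funext=> -[]].
  + exact: (mon_cst (Cell i None)).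
Qed.

(** Every nonconstant member of the monoid sends [Zero] to a base point. This
    makes the slices through the origin decisive: see [mon_nonbase]. *)
Definition base (x : point) : bool :=
  match x with Zero | Cell _ None => true | _ => false end.

Lemma mon_nonbase u x : monoid_fun u -> ~~ base (u Zero) -> u x = u Zero.
Proof. by case. Qed.

Lemma mon_fix_base u : monoid_fun u ->
  u (Idx i0) = Idx i0 -> u (Idx i1) = Idx i1 -> forall x, base x -> u x = x.
Proof.
case=> [rho r _ _ _ _ [|?|?|? []] //|x|s|a i t] //=.
by move=> -> [].
Qed.

Lemma mon_sectionP u t0 t1 : monoid_fun u ->
  u (Idx i0) = Cell i0 t0 -> u (Idx i1) = Cell i1 t1 -> exists s, u = section s.
Proof.
case=> [rho r|x|s|a i t] //=; first by move=> -> [/i01].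
  by exists s.
by move=> [->] _ [/i01].
Qed.

Lemma mon_spikeP u i t : monoid_fun u -> u Zero = Cell i t ->
  (forall x, u x = Cell i t) \/ t = None /\ exists a t', u = spike a i t'.
Proof.
case=> [rho r|x|s|a j t'] //=; first by left.
by move=> [-> <-]; right; split=> //; exists a, t'.
Qed.

Definition live (x : point) : bool := if x is Cell _ (Some _) then true else false.

(** A spike is supported on two keys out of three; a constant base cell on none. *)
Lemma mon_parity u i : monoid_fun u -> u Zero = Cell i None ->
  live (u (Key None)) (+) (live (u (Key (Some true))) (+) live (u (Key (Some false))))
  = false.
Proof.
move=> mu /(mon_spikeP mu)[e|[_ [a [t ->]]]]; first by rewrite !e.
by case: a => [[]|].
Qed.

(** * Binary operations preserving the monoid *)

Definition compat2 (g : point -> point -> point) : Prop :=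
  forall h1 h2, monoid_fun h1 -> monoid_fun h2 -> monoid_fun (fun x => g (h1 x) (h2 x)).

Lemma compat2_row g y : compat2 g -> monoid_fun (g^~ y).
Proof. by move=> gb; apply: (gb id (fun=> y)); [exact: mon_id|constructor]. Qed.

Lemma compat2_col g x : compat2 g -> monoid_fun (g x).
Proof. by move=> gb; apply: (gb (fun=> x) id); [constructor|exact: mon_id]. Qed.

Lemma compat2_diag g rho : compat2 g -> injective rho ->
  monoid_fun (fun x => g x (act rho (fun=> id) x)).
Proof.
by move=> gb rhoI; apply: (gb id); [exact: mon_id|constructor=> //; exact: lowering_id].
Qed.

(** A column starting at a nonbase value is constant, and an [act] takes nonbase
    values at the nonbase points; a row that is already known there can only be
    an [act], which fixes the base points. *)
Lemma compat2_act g rho r : compat2 g ->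
  (forall x, g x Zero = act rho r x) -> forall x y, g x y = act rho r x.
Proof.
move=> gb e x y.
have nb z : ~~ base z -> g z y = act rho r z.
  move=> zb; rewrite -e (mon_nonbase _ (compat2_col z gb)) // e.
  by case: z zb => //= i [].
case: (boolP (base x)) => [xb|/nb //].
rewrite (mon_fix_base (compat2_row y gb)) ?nb //.
by case: x xb => //= i [].
Qed.

Lemma exists_other_key (a : key) : exists b : key, b != a.
Proof. by case: a => [a|]; [exists None|exists (Some true)]. Qed.

Lemma exists_mapping (a b : key) : exists2 rho : key -> key, injective rho & rho a = b.
Proof.
exists (fun c => if c == a then b else if c == b then a else c); last by rewrite eqxx.
by case: a b => [[]|] [[]|] [[]|] [[]|].
Qed.

Lemma mon_live_const u a i t : monoid_fun u ->
  (forall b, b != a -> u (Key b) = Cell i (Some t)) ->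
  (forall x, u x = Cell i (Some t)) \/ u = spike a i t.
Proof.
have [b ba] := exists_other_key a.
case=> [rho r _ _|x|s|a' i' t'] e; first by have := e b ba.
- by left=> _; exact: e ba.
- by have := e b ba.
- right; have := e b ba; rewrite /spike; case: ifP => // _ [-> ->].
  have [->//|a'a] := eqVneq a' a.
  by have := e a' a'a; rewrite /spike/= eqxx.
Qed.

(** If some row were constant, [g] would be the disjunction of a spike in [x] and
    a spike in [y]. Permuting the keys in the second variable so that the two
    supports cover all three keys, the diagonal violates [mon_parity]. *)
Lemma compat2_spike g a i t : compat2 g ->
  (forall x, g x Zero = spike a i t x) -> forall x y, g x y = spike a i t x.
Proof.
move=> gb e.
have live_row b y : b != a -> g (Key b) y = Cell i (Some t).
  by move=> ba; rewrite (mon_nonbase y (compat2_col _ gb)) e /spike/= ba.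
have rows y := mon_live_const (compat2_row y gb) (fun b => @live_row b y).
move=> x y; case: (rows y) => [cst|e']; last exact: (congr1 (fun u => u x) e').
have e00 : g Zero Zero = Cell i None by rewrite e.
case: (mon_spikeP (compat2_col Zero gb) e00) => [/(_ y)|[_ [a2 [t2 col]]]].
  by rewrite cst.
have [a2' a2'2] := exists_other_key a2.
have [rho rhoI rhoa] := exists_mapping a a2'.
have := mon_parity (compat2_diag gb rhoI) e00.
have all_live b : live (g (Key b) (Key (rho b))).
  have [->|ba] := eqVneq b a; last by rewrite live_row.
  case: (rows (Key (rho a))) => [->//|/(congr1 (fun u => u Zero))].
  by rewrite [LHS](congr1 (fun u => u _) col) /spike /= rhoa a2'2.
by rewrite /= !all_live.
Qed.

Definition label (x : point) : option I :=
  match x with Idx i | Cell i _ => Some i | _ => None end.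

Lemma mon_zero_label u : monoid_fun u -> u Zero = Zero ->
  (forall x, u x = Zero) \/ forall i, label (u (Idx i)) = Some i.
Proof. by case=> [rho r|x|s|a i t] //=; [right|left|right]. Qed.

(** The members of the monoid that fix [Zero] preserve fibres, so they can be read
    backwards: a value over [i] comes from an argument over [i]. *)
Lemma mon_label_inv u x i : monoid_fun u -> u Zero = Zero ->
  label (u x) = Some i -> label x = Some i.
Proof. by case=> [rho r _ _|y|s|a j t] //=; [case: x|move=> ->|case: x]. Qed.

Definition key_map (p q r : key) (a : key) : key :=
  match a with None => p | Some true => q | Some false => r end.

(** Over the field with two elements: the conditions on the six transversals give
    m_ij + m_kl = m_il + m_kj, so m_ij = a_i + b_j; the row sums then make a
    constant and the column sums make b constant, so m is a constant c with
    3c = 0. The proof enumerates the matrices. *)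
Lemma even_lines (m : key -> key -> bool) :
  let even l := l None (+) (l (Some true) (+) l (Some false)) = false in
  (forall b, even (m b)) -> (forall c, even (m^~ c)) ->
  (forall rho, injective rho -> even (fun b => m b (rho b))) ->
  forall b c, m b c = false.
Proof.
move=> even rows cols diags.
have diag p q r : p != q -> p != r -> q != r -> even (fun b => m b (key_map p q r b)).
  move=> pq pr qr; apply: diags => -[[]|] [[]|] //= e; move: pq pr qr;
  by rewrite e eqxx.
have := diag None (Some true) (Some false) isT isT isT.
have := diag None (Some false) (Some true) isT isT isT.
have := diag (Some true) None (Some false) isT isT isT.
have := diag (Some true) (Some false) None isT isT isT.
have := diag (Some false) None (Some true) isT isT isT.
have := diag (Some false) (Some true) None isT isT isT.
have := rows None; have := rows (Some true); have := rows (Some false).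
have := cols None; have := cols (Some true); have := cols (Some false).
rewrite /even /= => + + + + + + + + + + + + b c.
case: b c => [[]|] [[]|];
move: (m None None) (m None (Some true)) (m None (Some false))
  (m (Some true) None) (m (Some true) (Some true)) (m (Some true) (Some false))
  (m (Some false) None) (m (Some false) (Some true)) (m (Some false) (Some false));
by do 9! case.
Qed.

(** No conjunction can appear. At the base point [Zero], a nonconstant row at [y]
    meets all fibres, and reading the columns backwards puts [y] in two fibres at
    once. At a base cell, only spikes occur, and the nonbase entries at pairs of
    keys form a matrix as in [even_lines]. *)
Lemma compat2_zero g z : compat2 g ->
  (forall x, g x Zero = z) -> (forall y, g Zero y = z) -> forall x y, g x y = z.
Proof.
move=> gb ex ey.
case zb : (base z); last first.
  by move=> x y; rewrite (mon_nonbase x (compat2_row y gb)) ey // zb.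
have row y : monoid_fun (g^~ y) := compat2_row y gb.
have col x : monoid_fun (g x) := compat2_col x gb.
case: z zb ex ey => // [_|i [//|] _] ex ey x y.
- case: (mon_zero_label (row y) (ey y)) => // lbl.
  have ly i : label y = Some i.
    exact: (mon_label_inv (col (Idx i)) (ex (Idx i)) (lbl i)).
  by have := ly i0; rewrite (ly i1) => -[/esym].
- have dead b c : live (g (Key b) (Key c)) = false.
    move: b c; apply: even_lines => [b|c|rho rhoI].
    + exact: (mon_parity (col (Key b)) (ex (Key b))).
    + exact: (mon_parity (row (Key c)) (ey (Key c))).
    + exact: (mon_parity (compat2_diag gb rhoI) (ex Zero)).
  case: (mon_spikeP (row y) (ey y)) => [//|[_ [a [t e]]]].
  have [b ba] := exists_other_key a.
  have gby : g (Key b) y = Cell i (Some t).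
    by rewrite [LHS](congr1 (fun u => u _) e) /spike /= ba.
  case: (mon_spikeP (col (Key b)) (ex (Key b))) => [/(_ y)|[_ [a' [t' e']]]].
    by rewrite gby.
  move: gby; rewrite e' /spike; case: y {e} dead => // c.
  by move=> dead e; have := dead b c; rewrite e' /spike; case: ifP e.
Qed.

(** * Operations of arbitrary arity preserving the monoid *)

Section Arity.
Context (n : nat).
Implicit Types (f : ('I_n.+1 -> point) -> point) (c : 'I_n.+1 -> point).

Definition upd c (k : 'I_n.+1) (x : point) : 'I_n.+1 -> point :=
  fun i => if i == k then x else c i.

Definition zeros : 'I_n.+1 -> point := fun=> Zero.

Definition compat f : Prop :=
  forall h : 'I_n.+1 -> point -> point,
    (forall i, monoid_fun (h i)) -> monoid_fun (fun x => f (fun i => h i x)).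

Lemma upd_id c k x : c k = x -> upd c k x = c.
Proof. by move=> e; apply/funext=> i; rewrite /upd; case: eqP => [->|]. Qed.

Lemma updC c j k x y : j != k -> upd (upd c j y) k x = upd (upd c k x) j y.
Proof.
move=> jk; apply/funext=> i; rewrite /upd.
by have [->|//] := eqVneq i k; rewrite eq_sym (negbTE jk).
Qed.

Lemma upd_upd c k x y : upd (upd c k x) k y = upd c k y.
Proof. by apply/funext=> i; rewrite /upd; case: eqP. Qed.

Lemma compat_compat2 f c j k : compat f -> compat2 (fun x y => f (upd (upd c j y) k x)).
Proof.
move=> fc h1 h2 m1 m2.
pose h i := if i == k then h1 else if i == j then h2 else fun=> c i.
rewrite (_ : (fun x => _) = fun x => f (h^~ x)).
  by apply: fc => i; rewrite /h; case: ifP => // _; case: ifP => // _; constructor.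
apply/funext=> x; congr f; apply/funext=> i; rewrite /upd /h.
by case: ifP => // _; case: ifP.
Qed.

Lemma compat_row f c k : compat f -> monoid_fun (fun x => f (upd c k x)).
Proof.
move=> fc; have := compat2_row (c k) (compat_compat2 c k k fc).
by rewrite upd_id.
Qed.

Lemma compat_freeze f j y : compat f -> compat (fun c => f (upd c j y)).
Proof.
move=> fc h hm; pose h' i := if i == j then fun=> y else h i.
rewrite (_ : (fun x => _) = fun x => f (h'^~ x)).
  by apply: fc => i; rewrite /h'; case: ifP => // _; constructor.
by apply/funext=> x; congr f; apply/funext=> i; rewrite /upd /h'; case: ifP.
Qed.

(** Induction on the arguments rather than on the arity: coordinates are fixed one
    at a time and the operation keeps its type. *)
Lemma freeze_ind (Q : (('I_n.+1 -> point) -> point) -> Prop) (D : {pred 'I_n.+1}) f c :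
  (forall f j y, j \in D -> Q f -> Q (fun c => f (upd c j y))) ->
  Q f -> Q (fun c' => f (fun i => if i \in D then c i else c' i)).
Proof.
move=> step Qf.
suff H (s : seq 'I_n.+1) : {subset s <= D} ->
    Q (fun c' => f (fun i => if i \in s then c i else c' i)).
  rewrite (_ : (fun c' => _) =
      fun c' => f (fun i => if i \in enum D then c i else c' i)).
    by apply: H => i; rewrite mem_enum.
  by apply/funext=> c'; congr f; apply/funext=> i; rewrite mem_enum.
elim: s => [//|j s IH] sD.
have Qs := IH (fun i si => sD i (@mem_behead _ (j :: s) i si)).
rewrite (_ : (fun c' => _) =
    fun c' => f (fun i => if i \in s then c i else upd c' j (c j) i)).
  exact: (step _ j (c j) (sD _ (mem_head _ _)) Qs).
apply/funext=> c'; congr f; apply/funext=> i; rewrite inE /upd.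
by case: eqP => [->|//]; rewrite orTb; case: ifP.
Qed.

(** After freezing coordinate [j], the slices through the origin are still
    constant, by [compat2_zero] applied to the coordinates [j] and [k]. *)
Lemma nary_zero f z : compat f ->
  (forall k x, f (upd zeros k x) = z) -> forall c, f c = z.
Proof.
move=> fc fz c.
pose Q f := compat f /\ forall k x, f (upd zeros k x) = z.
have [|_ /(_ ord0 Zero)//] := @freeze_ind Q predT f c _ (conj fc fz).
move=> {fc fz c}f j y _ [fc fz]; split=> [|k x]; first exact: compat_freeze.
have [->|jk] := eqVneq j k; first by rewrite upd_upd fz.
rewrite -updC //; apply: (compat2_zero (compat_compat2 zeros j k fc)) => [{}x|{}y].
  by rewrite (@upd_id zeros).
by rewrite upd_id ?fz // /upd eq_sym (negbTE jk).
Qed.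

(** The premise on [u] is supplied by [compat2_act] or [compat2_spike]. *)
Lemma nary_stable f k u :
  (forall g, compat2 g -> (forall x, g x Zero = u x) -> forall x y, g x y = u x) ->
  compat f -> (forall x, f (upd zeros k x) = u x) -> forall c, f c = u (c k).
Proof.
move=> stable fc fu c.
pose Q f := compat f /\ forall x, f (upd zeros k x) = u x.
have [|_ /(_ (c k))] := @freeze_ind Q (predC1 k) f c _ (conj fc fu); last first.
  move=> <-; congr f; apply/funext=> i; rewrite /upd inE.
  by case: eqP => // ->.
move=> {fc fu c}f j y jk [fc fu]; split=> [|x]; first exact: compat_freeze.
rewrite -updC //; apply: (stable _ (compat_compat2 zeros j k fc)) => {}x.
by rewrite (@upd_id zeros).
Qed.

Lemma nary_cell f i t0 : compat f -> f zeros = Cell i t0 ->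
  (forall c, f c = Cell i t0) \/
  t0 = None /\ exists j a t, forall c, f c = spike a i t (c j).
Proof.
move=> fc f0.
have [fz|/existsNP[k /existsNP[x fkx]]] :=
    pselect (forall k x, f (upd zeros k x) = Cell i t0).
  by left; exact: nary_zero.
have fk0 : f (upd zeros k Zero) = Cell i t0 by rewrite upd_id.
case: (mon_spikeP (compat_row zeros k fc) fk0) => [//|[t0N [a [t e]]]].
right; split=> //; exists k, a, t; apply: nary_stable => //.
  by move=> g; exact: compat2_spike.
by move=> {fkx}x; rewrite -e.
Qed.

(** Once coordinate [k] is frozen at [Idx i], [nary_cell] describes the rest for
    each [i] separately. These descriptions fit together because the slice in
    direction [k] is a section: a section takes base cells everywhere or nowhere,
    so all the spikes open simultaneously. *)
Lemma nary_section f k s : compat f ->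
  (forall x, f (upd zeros k x) = section s x) ->
  (forall c, f c = section s (c k)) \/
  exists j a s', forall c, f c = gate a s' (c k) (c j).
Proof.
move=> fc fs.
pose F i c := f (upd c k (Idx i)).
have FC i : (forall c, F i c = section s (Idx i)) \/
    s = None /\ exists j a t, forall c, F i c = spike a i t (c j).
  have [|[/= sN H]] := @nary_cell (F i) i _ (compat_freeze k (Idx i) fc) (fs (Idx i)).
    by left.
  by right; split=> //; case: (s) sN.
have slice c : exists s', forall x, f (upd c k x) = section s' x.
  have idx i : exists t, F i c = Cell i t.
    by case: (FC i) => [->|[_ [j [a [t ->]]]]]; [exists (omap (@^~ i) s)|eexists].
  have [[t0 e0] [t1 e1]] := (idx i0, idx i1).
  have [s' e] := mon_sectionP (compat_row c k fc) e0 e1.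
  by exists s' => x; rewrite -e.
have sliceE c s' : (forall i, F i c = section s' (Idx i)) -> f c = section s' (c k).
  move=> e; have [s'' es''] := slice c.
  rewrite -[in LHS](@upd_id c k (c k)) // es''.
  by case: (c k) => //= i; have := e i; rewrite /F es''.
(* one spike in coordinate j, over a single index i, decides where f is a gate *)
have [cst|/existsNP[i /existsNP[c0 nc]]] :=
    pselect (forall i c, F i c = section s (Idx i)).
  by left=> c; exact: sliceE.
right; case: (FC i) => [/(_ c0)//|[sN [j [a [t Fi]]]]] {c0 nc}.
have [b ba] := exists_other_key a.
have sliceN c s' :
    (forall x, f (upd c k x) = section s' x) -> isSome s' = opens a (c j).
  move=> e; have := Fi c; rewrite /F e /spike /= => -[].
  by case: s' {e} => /=; case: ifP.
have [[s1|] e1] := slice (fun=> Key b); last by have := sliceN _ _ e1; rewrite /= ba.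
exists j, a, s1 => c; apply: sliceE => i'.
have [s' e] := slice c; have := sliceN c s' e.
case: (FC i') => [cst|[_ [j' [a' [t' Fi']]]]].
  by have := e1 (Idx i'); have := cst (fun=> Key b); rewrite /F sN => ->.
have := Fi' (fun=> Key b); have := Fi' c; rewrite /F e e1 /spike /=.
case: s' {e} => [s'|] /=; last by move=> _ _ <-.
by case: ifP => // _ [->]; case: ifP => // _ [<-] <-.
Qed.

(** If every slice through the origin is constant, so is [f]; otherwise a
    nonconstant one shows which variable matters. Only a section leaves room for a
    second variable. *)
Lemma compat_classification f : compat f ->
  (exists u k, monoid_fun u /\ forall c, f c = u (c k)) \/
  (exists k j a s, forall c, f c = gate a s (c k) (c j)).
Proof.
move=> fc.
have [fz|/existsNP[k /existsNP[x fkx]]] :=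
    pselect (forall k x, f (upd zeros k x) = f zeros).
  by left; exists (fun=> f zeros), ord0; split; [constructor|exact: nary_zero].
have fk0 : f (upd zeros k Zero) = f zeros by rewrite upd_id.
have [u mu fu] : exists2 u, monoid_fun u & forall x, f (upd zeros k x) = u x.
  by eexists; first exact: (compat_row zeros k fc).
have unary_case : (forall g, compat2 g -> (forall x, g x Zero = u x) ->
    forall x y, g x y = u x) -> exists u k, monoid_fun u /\ forall c, f c = u (c k).
  by move=> st; exists u, k; split=> //; exact: nary_stable.
case: mu fu unary_case => [rho r rhoI rl|y|s|a i t] fu unary_case.
- by left; apply: unary_case => g; exact: compat2_act.
- by case: fkx; rewrite fu -fk0 fu.
- case: (nary_section fc fu) => [e|[j [a [s' e]]]].
    by left; exists (section s), k; split=> //; constructor.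
  by right; exists k, j, a, s'.
- by left; apply: unary_case => g; exact: compat2_spike.
Qed.

End Arity.

(** * The clones of gates *)

Definition gates (J : set P) : set (operation point) := fun o =>
  let: Op n f := o in
  (exists u k, monoid_fun u /\ f = fun c => u (c k)) \/
  (exists k j a s, J (rank s) /\ f = fun c => gate a s (c k) (c j)).

Definition monop (u : point -> point) : operation point :=
  @Op point 0 (fun c => u (c ord0)).

Definition monops : set (operation point) := [set monop u | u in monoid_fun].

Lemma monop_inj : injective monop.
Proof.
move=> u v /(congr1 (fun o => let: Op n f := o in fun x : point => f (fun=> x))).
exact.
Qed.

Lemma gate_diag a s x : gate a s x x = section None x.
Proof. by case: x. Qed.

Lemma gates_unary J : gates J `&` unary point = monops.
Proof.
apply/seteqP; split=> [o [Jo [f _ fo]]|_ [u mu <-]].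
  move: Jo; rewrite -fo => -[[u [k [mu ->]]]|[k [j [a [s [_ ->]]]]]].
    by exists u => //; rewrite (ord1 k).
  exists (section None); first by constructor.
  rewrite /monop; congr Op; apply/funext=> c.
  by rewrite (ord1 k) (ord1 j) gate_diag.
by split; [left; exists u, ord0|exists (fun c => u (c ord0))].
Qed.

Lemma gates_comp J n f u : order_ideals J -> monoid_fun u ->
  gates J (@Op _ n f) -> gates J (@Op _ n (fun c => u (f c))).
Proof.
move=> idJ mu [[v [k [mv ->]]]|[k [j [a [s [Js ->]]]]]].
  by left; exists (u \o v), k; split=> //; exact: mon_comp.
case: mu => [rho r rhoI rl|x|s'|a' i t].
- right; exists k, j, a, (fun i => r i (s i)); split; first exact: idJ (rl s) Js.
  by apply/funext=> c; rewrite act_section /gate; case: ifP.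
- by left; exists (fun=> x), ord0; split=> //; constructor.
- left; exists (fun=> Zero), ord0; split; first by constructor.
  by apply/funext=> c; case: (c k).
- left; exists (fun=> Cell i None), ord0; split; first by constructor.
  by apply/funext=> c; case: (c k).
Qed.

(** A gate reacts to a value of [f] only if it is an index, and to a value of [g]
    only if it is a key; both are missing from the values of gates, sections and
    spikes. With [g] essentially an [act], the key is merely relabelled; with [f]
    constant the gate becomes a spike or a constant. *)
Lemma gates_gate J n f g a s : order_ideals J -> J (rank s) ->
  gates J (@Op _ n f) -> gates J (@Op _ n g) ->
  gates J (@Op _ n (fun c => gate a s (f c) (g c))).
Proof.
move=> idJ Js Jf Jg.
have sec_case s' : (forall c, gate a s (f c) (g c) = section s' (f c)) ->
    gates J (@Op _ n (fun c => gate a s (f c) (g c))).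
  move=> e; rewrite (_ : (fun c => _) = fun c => section s' (f c)); last exact/funext.
  by apply: gates_comp => //; constructor.
case: Jg => [[v [j [mv eg]]]|[k [j [a' [s' [_ eg]]]]]]; last first.
  by apply: (sec_case None) => c; rewrite eg /gate; case: (c k).
case: mv eg => [rho r rhoI rl|x|s'|a' i t] eg.
- case: Jf sec_case => [[w [k [mw ef]]]|[k [j' [a' [s' [_ ef]]]]]] _; last first.
    left; exists (fun=> Zero), ord0; split; first by constructor.
    by apply/funext=> c; rewrite ef; case: (c k).
  case: mw ef => [rho' r' _ _|x|s'|a' i t] ef.
  + right; exists k, j, (invF rhoI a), s; split=> //.
    by apply/funext=> c; rewrite ef eg /gate opens_act section_act.
  + case: x ef => [|b|i|i t] ef;
      try by left; exists (fun=> Zero), ord0; split;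
        [constructor|apply/funext=> c; rewrite ef].
    left; exists (spike (invF rhoI a) i (s i)), j; split; first by constructor.
    by apply/funext=> c; rewrite ef eg /gate /spike opens_act; case: ifP.
  + left; exists (fun=> Zero), ord0; split; first by constructor.
    by apply/funext=> c; rewrite ef; case: (c k).
  + left; exists (fun=> Zero), ord0; split; first by constructor.
    by apply/funext=> c; rewrite ef.
- by apply: (sec_case (if opens a x then Some s else None)) => c; rewrite eg.
- by apply: (sec_case None) => c; rewrite eg /gate; case: (c j).
- by apply: (sec_case None) => c; rewrite eg.
Qed.

Lemma gates_clone J : order_ideals J -> is_clone (gates J).
Proof.
move=> idJ; split=> [n k|n m f g].
  by left; exists id, k; split=> //; exact: mon_id.
move=> [[u [k [mu ->]]]|[k [j [a [s [Js ->]]]]]] Jg.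
  exact: gates_comp (Jg k).
exact: gates_gate (Jg k) (Jg j).
Qed.

(** The section of a gate can be read off its values, so a gate is in only those
    clones that it is supposed to be in. *)
Lemma gates_type J n (k j : 'I_n.+1) a s : k != j ->
  gates J (Op (fun c => gate a s (c k) (c j))) -> J (rank s).
Proof.
move=> kj Jg.
have [b ba] := exists_other_key a.
pose w x i := upd (upd (@zeros n) j x) k (Idx i).
have wE x i l : w x i l = if l == k then Idx i else if l == j then x else Zero by [].
have gw x i : gate a s (w x i k) (w x i j) =
    Cell i (if opens a x then Some (s i) else None).
  by rewrite !wE !eqxx eq_sym (negbTE kj) /gate; case: opens.
have opens_b : opens a (Key b) := ba.
case: Jg => [[u [k' [_ e]]]|[k' [j' [a' [s' [Js' e]]]]]].
  have {e}uw x i : u (w x i k') = Cell i (if opens a x then Some (s i) else None).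
    by rewrite -gw [RHS](congr1 (fun f => f (w x i)) e).
  have := uw (Key b) i0; have := uw Zero i0; have := uw (Key b) i1.
  rewrite !wE opens_b; case: (k' == k) => [_ -> //|].
  by case: (k' == j) => [-> _ [/esym]|_ -> //].
suff -> : s = s' by [].
apply/funext=> i; have := congr1 (fun f => f (w (Key b) i)) e.
rewrite gw opens_b !wE; case: (k' == k); last by case: (k' == j).
by rewrite /gate; case: opens => //= -[].
Qed.

(** * The clones of the interval *)

Lemma clone_monop C n f u : is_clone C -> C `&` unary point = monops -> monoid_fun u ->
  C (@Op _ n f) -> C (@Op _ n (fun c => u (f c))).
Proof.
move=> [_ Cc] Cu mu Cf.
have [Cm _] : (C `&` unary point) (monop u) by rewrite Cu; exists u.
exact: (Cc 0 n _ (fun=> f) Cm (fun=> Cf)).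
Qed.

Lemma clone_compat C n f : is_clone C -> C `&` unary point = monops ->
  C (@Op _ n f) -> compat f.
Proof.
move=> Cclone Cu Cf h hm.
have Ch i : C (monop (h i)).
  exact: (clone_monop Cclone Cu (hm i) (Cclone.1 _ _)).
have : (C `&` unary point) (monop (fun x => f (h^~ x))).
  split; first exact: (Cclone.2 n 0 f (fun i c => h i (c ord0)) Cf Ch).
  by exists (fun c => f (fun i => h i (c ord0))).
by rewrite Cu => -[u mu /monop_inj <-].
Qed.

Context (rank_star : forall s i, s i = star -> rank s = \bot%O).

(** Off the section [s], the map [r] creates a value [star]; so no other section
    can have its rank increased. *)
Lemma exists_lowering s s' : (rank s' <= rank s)%O ->
  exists2 r, lowering r & forall i, r i (s i) = s' i.
Proof.
move=> le_s; exists (fun i t => if t == s i then s' i else star); last first.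
  by move=> i; rewrite eqxx.
move=> s2; have [/funext->|/existsNP[i /eqP si]] := pselect (forall i, s2 i = s i).
  by rewrite (_ : (fun i => _) = s') //; apply/funext=> i; rewrite eqxx.
by rewrite (rank_star (i := i)) ?le0x // (negbTE si).
Qed.

(** The maps [act rho id] in the second variable change the key, the lowering maps
    on the outside change the section. *)
Lemma gate_transfer C n (k j : 'I_n.+1) a s m (k' j' : 'I_m.+1) a' s' :
  is_clone C -> C `&` unary point = monops -> k != j -> (rank s' <= rank s)%O ->
  C (Op (fun c => gate a s (c k) (c j))) ->
  C (Op (fun c => gate a' s' (c k') (c j'))).
Proof.
move=> Cclone Cu kj /exists_lowering[r rl rs] Cg.
have [rho rhoI rhoa] := exists_mapping a' a.
pose h i c := if i == k then c k' else act rho (fun=> id) (c j').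
have Ch i : C (@Op _ m (h i)).
  rewrite /h; case: (i == k); first exact: Cclone.1.
  by apply: (clone_monop Cclone Cu) (Cclone.1 _ _); constructor => //; exact: lowering_id.
have mr : monoid_fun (act id r) by constructor.
have := clone_monop Cclone Cu mr (Cclone.2 _ _ _ h Cg Ch).
rewrite (_ : (fun c => _) = fun c => gate a' s' (c k') (c j')) //.
apply/funext=> c; rewrite /compose /h eqxx eq_sym (negbTE kj) act_section opens_act /gate.
have -> : invF rhoI a = a' by rewrite -rhoa invF_f.
by case: opens => //=; congr (section (Some _) _); apply/funext.
Qed.

Context (rank_surj : forall p, exists s, rank s = p).

Lemma interval_gates C : is_clone C -> C `&` unary point = monops ->
  exists2 J, order_ideals J & gates J = C.
Proof.
move=> Cclone Cu.
pose g2 s : operation point := @Op _ 1 (fun c => gate None s (c ord0) (c ord_max)).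
exists [set p | exists2 s, rank s = p & C (g2 s)].
  move=> p _ /[swap] -[s <- Cs] /=; have [s' <-] := rank_surj p => le_s.
  by exists s' => //; apply: (gate_transfer _ _ _ Cclone Cu _ le_s Cs).
apply/seteqP; split=> -[n f].
  case=> [[u [k [mu ->]]]|[k [j [a [s [[s' ts Cs] ->]]]]]].
    exact: clone_monop Cclone Cu mu (Cclone.1 _ _).
  by apply: (gate_transfer _ _ _ Cclone Cu _ _ Cs) => //; rewrite ts.
move=> Cf.
have [[u [k [mu e]]]|[k [j [a [s e]]]]] :=
    compat_classification (clone_compat Cclone Cu Cf).
  by left; exists u, k; split=> //; exact/funext.
have [kj|kj] := eqVneq k j.
  left; exists (section None), k; split; first by constructor.
  by apply/funext=> c; rewrite e kj gate_diag.
right; exists k, j, a, s; split; last exact/funext.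
exists s => //; apply: (gate_transfer _ _ _ Cclone Cu kj (lexx _)).
by move: Cf; rewrite (funext e); exact.
Qed.

(** The joins are unions, since the union of two order ideals is one. *)
Lemma point_interval : is_submonoid monops /\
  lattice_isomorphic (@order_ideals d P) setI setU
    (monoidal_interval monops) setI (@clone_join point).
Proof.
split.
  split=> [_ [u mu <-]||f g].
  - by exists (fun c => u (c ord0)).
  - by exists id => //; exact: mon_id.
  - have E : monops = gates set0 `&` unary point by rewrite gates_unary.
    have gc : is_clone (gates set0) by apply: gates_clone.
    rewrite E => -[gf _] [gg _]; split; first exact: gc.2.
    by eexists.
have gates_sub J K : gates J `<=` gates K -> J `<=` K.
  move=> JK p Jp; have [s ts] := rank_surj p; rewrite -ts in Jp *.
  have := JK (@Op _ 1 (fun c => gate None s (c ord0) (c ord_max))).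
  move=> /(_ _)/gates_type; apply=> //.
  by right; exists ord0, ord_max, None, s.
have gates_mono J K : J `<=` K -> gates J `<=` gates K.
  move=> JK [n f] [?|[k [j [a [s [Js ->]]]]]]; first by left.
  by right; exists k, j, a, s; split=> //; exact: JK.
exists gates; split.
- split=> [J idJ|J K _ _ e|C [Cclone Cu]].
  + by split; [exact: gates_clone|exact: gates_unary].
  + by apply/seteqP; split; apply: gates_sub; rewrite e.
  + by have [J idJ <-] := interval_gates Cclone Cu; exists J.
- move=> J K idJ idK; apply/seteqP; split.
    by move=> o JKo; split; apply: (gates_mono _ _ _ _ JKo) => p [].
  move=> [n f] [[gf _|]]; first by left.
  move=> [k [j [a [s [Js ->]]]]] Kg.
  have [kj|kj] := eqVneq k j.
    left; exists (section None), k; split; first by constructor.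
    by apply/funext=> c; rewrite kj gate_diag.
  right; exists k, j, a, s; split=> //; split=> //.
  exact: gates_type kj Kg.
- move=> J K idJ idK; apply/seteqP; split.
    move=> [n f] [g|[k [j [a [s [[Js|Ks] ->]]]]]] C [_ JKC]; apply: JKC.
    + by left; left.
    + by left; right; exists k, j, a, s.
    + by right; right; exists k, j, a, s.
  apply: smallest_sub; last by move=> o [] /gates_mono; apply=> p; [left|right].
  by apply: gates_clone => p q pq [/(idJ _ _ pq)|/(idK _ _ pq)]; [left|right].
Qed.

End Points.

(** * An infinite set absorbs a countable factor *)

Lemma card_leT_inj T U (u0 : U) : [set: T] #<= [set: U] ->
  exists f : T -> U, injective f.
Proof.
elim/Ppointed: U => U in u0 *; first by have : [set: U] u0 by []; rewrite emptyE.
by move=> /pcard_injP[f fI]; exists f => x y; apply: fI; rewrite in_setT.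
Qed.

Lemma Cantor_Bernstein_fun X Y (y0 : Y) (f : X -> Y) (g : Y -> X) :
  injective f -> injective g -> exists e : X -> Y, bijective e.
Proof.
have inj_le T U (h : T -> U) : injective h -> [set: T] #<= [set: U].
  move=> hI; have [h'] : $|{injfun [set: T] >-> [set: U]}|.
    by apply/injfunPex; exists h => // x y _ _; exact: hI.
  exact: inj_card_le h'.
move=> /inj_le fle /inj_le gle; have := Cantor_Bernstein fle gle.
elim/Ppointed: Y => Y in y0 {f g fle gle} *;
  first by have : [set: Y] y0 by []; rewrite emptyE.
by move=> /card_set_bijP[e]; exists e; rewrite -setTT_bijective.
Qed.

Lemma infinite_inj (T : Type) (A : set T) : infinite_set A ->
  exists2 s : nat -> T, injective s & range s `<=` A.
Proof.
move=> Ainf; have [t0 _] := infinite_setN0 Ainf.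
elim/Ppointed: T => T in A Ainf t0 *;
  first by have : [set: T] t0 by []; rewrite emptyE.
move: Ainf => /infiniteP/pcard_leP[f]; exists f.
  by move=> m n; apply: inj; rewrite in_setT.
by move=> _ [n _ <-]; apply: funS.
Qed.

Section Absorption.
Context (X : Type).

(** Injective sequences with pairwise disjoint ranges; taking [r = s] gives the
    injectivity. *)
Definition disjoint_rays (S : set (nat -> X)) : Prop :=
  forall r s, S r -> S s -> forall m n, r m = s n -> r = s /\ m = n.

(** An infinite complement would contain one more injective sequence. *)
Lemma maximal_rays :
  exists2 S, disjoint_rays S & finite_set (~` [set x | exists s n, S s /\ s n = x]).
Proof.
have [|S [Sd Smax]] := @Zorn_bigcup _ disjoint_rays.
  move=> F Fd Ftot r s [R FR Rr] [R' FR' R's].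
  have [RR'|R'R] := Ftot _ _ FR FR'.
    exact: Fd FR' _ _ (RR' _ Rr) R's.
  exact: Fd FR _ _ Rr (R'R _ R's).
exists S => //; apply: contrapT => /infinite_inj[s sI sS].
have Ss m : ~ exists r n, S r /\ r n = s m by have := sS (s m); apply; exists m.
apply: (Smax (S `|` [set s])); first split.
- by move=> r; left.
- by move=> /(_ s (or_intror erefl)) Sbad; apply: (Ss 0); exists s, 0.
move=> r r' [Sr|->] [Sr'|->] m n e; first exact: Sd.
- by case: (Ss n); exists r, m.
- by case: (Ss m); exists r', n.
- by split=> //; exact: sI.
Qed.

(** [X] embeds into [S * nat] for a maximal family [S] of disjoint rays, the finite
    remainder being absorbed by a single ray; and [S * nat * nat] embeds into
    [S * nat], which embeds into [X]. *)
Lemma infinite_prod_nat_inj : infinite_set [set: X] ->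
  exists f : X * nat -> X, injective f.
Proof.
move=> Xinf; have [S Sd] := maximal_rays.
set R := ~` _ => Rfin.
have [s0 Ss0] : exists s0, S s0.
  apply: contrapT => S0; apply: Xinf; rewrite (_ : setT = R) //.
  by apply/seteqP; split=> // x _ [s [n [Ss _]]]; apply: S0; exists s.
have [c cI] : exists c : X -> nat, {in R &, injective c}.
  exact/pcard_injP/finite_set_countable.
(* odd positions code the points on the rays, even positions the remainder *)
have /choice[code codeP] x : exists q : (nat -> X) * nat, S q.1 /\
    ((exists2 n, q.1 n = x & q.2 = n.*2.+1) \/ R x /\ q = (s0, (c x).*2)).
  have [Rx|/contrapT[s [n [Ss sn]]]] := pselect (R x).
    by exists (s0, (c x).*2); split=> //; right.
  by exists (s, n.*2.+1); split=> //; left; exists n.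
have codeI : injective code.
  move=> x y; have [_ cx] := codeP x; have [_ cy] := codeP y => e.
  move: cx cy; rewrite -e => -[[n nx en]|[Rx ex]] [[m my em]|[Ry ey]].
  - by move: em; rewrite en -my => -[/double_inj <-]; rewrite nx.
  - by move: en; rewrite ey => /(congr1 odd); rewrite /= !odd_double.
  - by move: em; rewrite ex => /(congr1 odd); rewrite /= !odd_double.
  - by move: ey; rewrite ex => -[/double_inj/cI]; apply; exact: mem_set.
exists (fun p => (code p.1).1 (pickle ((code p.1).2, p.2))) => -[x m] [y n] /= e.
have [es en] := Sd _ _ (codeP x).1 (codeP y).1 _ _ e.
have [ec ->] := pcan_inj pickleK en.
congr pair; apply: codeI.
by rewrite (surjective_pairing (code x)) es ec -surjective_pairing.
Qed.

End Absorption.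

(** * Transport along a bijection *)

Section Conjugation.
Context (X Y : Type) (e : X -> Y) (e' : Y -> X).

Definition conjugate n (f : ('I_n.+1 -> X) -> X) : ('I_n.+1 -> Y) -> Y :=
  fun c => e (f (e' \o c)).

Definition conjugate_op (o : operation X) : operation Y :=
  let: Op n f := o in Op (conjugate f).

Context (eK : cancel e e').

Lemma conjugate_compose n m (f : ('I_n.+1 -> X) -> X)
    (g : 'I_n.+1 -> ('I_m.+1 -> X) -> X) :
  conjugate (compose f g) = compose (conjugate f) (fun i => conjugate (g i)).
Proof.
apply/funext=> c; rewrite /conjugate /compose; congr (e (f _)).
by apply/funext=> i /=; rewrite eK.
Qed.

Context (eK' : cancel e' e).

Lemma conjugate_proj n k : conjugate (@proj X n k) = @proj Y n k.
Proof. by apply/funext=> c; rewrite /conjugate /proj /= eK'. Qed.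

End Conjugation.

Lemma conjugate_opK X Y (e : X -> Y) (e' : Y -> X) :
  cancel e e' -> cancel (conjugate_op e e') (conjugate_op e' e).
Proof.
move=> eK [n f] /=; congr Op; apply/funext=> c; rewrite /conjugate eK; congr f.
by apply/funext=> i /=; rewrite eK.
Qed.

Section Preimage.
Context (X Y : Type) (e : X -> Y) (e' : Y -> X).
Context (eK : cancel e e') (eK' : cancel e' e).

Lemma is_clone_preimage (C : set (operation Y)) :
  is_clone C -> is_clone (conjugate_op e e' @^-1` C).
Proof.
move=> [Cp Cc]; split=> [n k|n m f g Cf Cg]; rewrite /preimage /=.
  by rewrite conjugate_proj.
by rewrite conjugate_compose //; exact: Cc.
Qed.

Lemma unary_preimage : conjugate_op e e' @^-1` unary Y = unary X.
Proof.
apply/seteqP; split=> o; last by move=> [f _ <-]; exists (conjugate e e' f).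
move=> [f _ fo]; exists (conjugate e' e f) => //.
by rewrite -[o](conjugate_opK eK) -fo.
Qed.

Lemma preimage_conjugateK (C : set (operation X)) :
  conjugate_op e e' @^-1` (conjugate_op e' e @^-1` C) = C.
Proof.
by apply/seteqP; split=> o /=; rewrite /preimage /= conjugate_opK.
Qed.

Lemma is_submonoid_preimage (G : set (operation Y)) :
  is_submonoid G -> is_submonoid (conjugate_op e e' @^-1` G).
Proof.
move=> [Gu Gp Gc]; split=> [o Go||f g Gf Gg].
- by rewrite -unary_preimage; exact: Gu.
- by rewrite /preimage /= conjugate_proj.
- by rewrite /preimage /= conjugate_compose //; exact: Gc.
Qed.

Lemma monoidal_interval_preimage (G C : set (operation Y)) :
  monoidal_interval G C ->
  monoidal_interval (conjugate_op e e' @^-1` G) (conjugate_op e e' @^-1` C).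
Proof.
move=> [Cc CG]; split; first exact: is_clone_preimage.
by rewrite -unary_preimage -preimage_setI CG.
Qed.

End Preimage.

Lemma clone_join_preimage_sub X Y (e : X -> Y) (e' : Y -> X) (C D : set (operation Y)) :
  cancel e e' -> cancel e' e ->
  conjugate_op e e' @^-1` clone_join C D `<=`
  clone_join (conjugate_op e e' @^-1` C) (conjugate_op e e' @^-1` D).
Proof.
move=> eK eK' o /= Jo M [Mc CDM].
rewrite -[M](preimage_conjugateK eK); apply: Jo; split; first exact: is_clone_preimage.
by move=> p CDp; apply: CDM; rewrite /preimage /= conjugate_opK.
Qed.

(** The inclusion [clone_join_preimage_sub] for the inverse bijection gives the
    converse one. *)
Lemma clone_join_preimage X Y (e : X -> Y) (e' : Y -> X) (C D : set (operation Y)) :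
  cancel e e' -> cancel e' e ->
  conjugate_op e e' @^-1` clone_join C D =
  clone_join (conjugate_op e e' @^-1` C) (conjugate_op e e' @^-1` D).
Proof.
move=> eK eK'; apply/seteqP; split; first exact: clone_join_preimage_sub.
rewrite -[X in X `<=` _](preimage_conjugateK eK); apply: preimage_subset.
by apply: subset_trans (clone_join_preimage_sub eK' eK) _; rewrite !preimage_conjugateK.
Qed.

Lemma lattice_isomorphic_transport X Y (e : X -> Y) L (A : set L) meetA joinA
    (G : set (operation Y)) : bijective e ->
  is_submonoid G ->
  lattice_isomorphic A meetA joinA (monoidal_interval G) setI (@clone_join Y) ->
  exists G' : set (operation X), is_submonoid G' /\
    lattice_isomorphic A meetA joinA (monoidal_interval G') setI (@clone_join X).
Proof.
move=> [e' eK eK'] Gm [phi [[phiAB phiI phiS] phim phij]].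
exists (conjugate_op e e' @^-1` G); split; first exact: is_submonoid_preimage.
exists (fun x => conjugate_op e e' @^-1` phi x); split; first split.
- by move=> x /phiAB; exact: monoidal_interval_preimage.
- move=> x y xA yA /(congr1 (preimage (conjugate_op e' e))).
  by rewrite !preimage_conjugateK //; exact: phiI.
- move=> C /(monoidal_interval_preimage eK' eK).
  rewrite preimage_conjugateK // => /phiS[x xA phix]; exists x => //.
  by rewrite phix preimage_conjugateK.
- by move=> x y xA yA; rewrite phim // preimage_setI.
- by move=> x y xA yA; rewrite phij // clone_join_preimage.
Qed.

(** * Encoding the set and the partial order *)

Lemma point_bijection X (T : countType) : infinite_set [set: X] ->
  exists e : X -> point X T, bijective e.
Proof.
move=> Xinf; have [x0 _] := infinite_setN0 Xinf.
have [f fI] := infinite_prod_nat_inj Xinf.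
pose tag (z : point X T) : X * (option key + option (option T)) :=
  match z with
  | Zero => (x0, inl None)
  | Key a => (x0, inl (Some a))
  | Idx i => (i, inr None)
  | Cell i t => (i, inr (Some t))
  end.
have tagI : injective tag by move=> [|a|i|i t] [|b|j|j t'] //= [] => [->|->|-> ->].
have IdxI : injective (@Idx X T) by move=> x y [].
pose g z := f ((tag z).1, pickle (tag z).2).
apply: (@Cantor_Bernstein_fun _ _ (Zero X T) _ g IdxI).
move=> z z' /fI[e1 e2]; apply: tagI.
by rewrite (surjective_pairing (tag z)) e1 (pcan_inj pickleK e2) -surjective_pairing.
Qed.

(** An element of [P] is coded by a subset of [X], hence by a section with values
    in [Some _]; the sections that code nothing get the least rank. The extra
    value [None] never occurs in a code. *)
Lemma exists_rank X (d : Order.disp_t) (P : bPOrderType d) :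
  [set: P] #<= [set: set X] ->
  exists rank : (X -> option bool) -> P,
    (forall s x, s x = None -> rank s = \bot%O) /\ forall p, exists s, rank s = p.
Proof.
move=> /(card_leT_inj set0)[iota iotaI].
pose code p x := Some `[< iota p x >].
have codeI : injective code.
  move=> p q e; apply/iotaI/funext=> x; apply/propext.
  exact: asbool_eq_equiv (Some_inj (congr1 (@^~ x) e)).
exists (fun s => if pselect (exists p, code p = s) is left h
                 then projT1 (cid h) else \bot%O); split=> [s x sx|p].
  by case: pselect => // h; case: (h) => p ps; move: sx; rewrite -(congr1 (@^~ x) ps).
exists (code p); case: pselect => [h|[]]; last by exists p.
by apply: codeI; exact: projT2 (cid h).
Qed.

Theorem theorem1 (X : Type) (hX : infinite_set [set: X])
    (d : Order.disp_t) (P : bPOrderType d)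
    (hP : [set: P] #<= [set: set X]) :
  exists G : set (operation X),
    is_submonoid G /\
    lattice_isomorphic
      (@order_ideals d P) setI setU
      (monoidal_interval G) setI (@clone_join X).
Proof.
have [rank [rank_star rank_surj]] := exists_rank hP.
have [s sI _] := infinite_inj hX.
have s01 : s 0 <> s 1 by move=> /sI.
have [e eb] := point_bijection (option bool) hX.
have [Gm Giso] := point_interval s01 rank_star rank_surj.
exact: lattice_isomorphic_transport eb Gm Giso.
Qed.
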